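(* Let $t=\overleftarrow\mu t[-1]$ be an injective-reachable seed satisfying the full rank assumption, such that $C^{t[-1]}(t)=-P_\sigma$ for some permutation $\sigma$ of $I_{uf}$. Let $\eta,g\in M^\circ(t)$ and put $\eta'=\psi_{t[-1],t}\eta$, $g'=\psi_{t[-1],t}g$. Then for $n\in N_{uf}(t)=\mathbb Z^{I_{uf}}$ we have $\eta=g+\tilde B(t)\cdot n$ if and only if $\eta'=g'+\tilde B(t[-1])\cdot(-P_\sigma\cdot n)$. In particular, $\eta\preceq_tg$ if and only if $\psi_{t[-1],t}\eta\succeq_{t[-1]}\psi_{t[-1],t}g$.
   Context: Conventions: $[a]_+=\max(a,0)$, $\mathbb N=\mathbb Z_{\ge 0}$. Fix a finite set $I=I_{uf}\sqcup I_{f}$ (unfrozen, frozen) and integers $d_i>0$. A seed $t=((b_{ij}(t))_{i,j\in I},(x_i(t))_{i\in I})$ has $b_{ij}d_j=-b_{ji}d_i$, $b_{ij}\in\mathbb Q$ if $i,j\in I_f$ and $b_{ij}\in\mathbb Z$ otherwise, and indeterminates $x_i(t)$. $\tilde B(t)=(b_{ik}(t))_{i\in I,k\in I_{uf}}$, $B(t)=(b_{ij}(t))_{i,j\in I_{uf}}$. Full rank assumption: $\tilde B(t)$ has rank $|I_{uf}|$ (preserved by mutation). $M^\circ(t)=\mathbb Z^I$ with basis $f_i$. Mutation: for $k\in I_{uf}$, $t'=\mu_kt$ has $b'_{ij}=-b_{ij}$ if $k\in\{i,j\}$ and $b'_{ij}=b_{ij}+b_{ik}[b_{kj}]_++[-b_{ik}]_+b_{kj}$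 otherwise; fraction fields of $\mathbb Z[x_i(t)^{\pm1}]$ are identified by $x_i'\mapsto x_i$ ($i\ne k$), $x_k'\mapsto x_k^{-1}\big(\prod_jx_j^{[-b_{jk}]_+}+\prod_jx_j^{[b_{jk}]_+}\big)$. $C$-matrices: for $t=\overleftarrow\mu t_0$, apply $\overleftarrow\mu$ (with the same matrix mutation rule) to the $(I_{uf}\sqcup I_{uf}')\times I_{uf}$ matrix with upper block $B(t_0)$ and lower block the identity, where $I_{uf}'$ is a copy of $I_{uf}$; the lower block of the result is $C^{t_0}(t)$. $P_\sigma$ is the $I_{uf}\times I_{uf}$ matrix with $(P_\sigma)_{ik}=\delta_{i,\sigma(k)}$. Tropical transformation $\phi_{\mu_kt,t}:M^\circ(t)\to M^\circ(\mu_kt)$: $g'_k=-g_k$, $g_i'=g_i+[b_{ik}]_+[g_k]_+-[-b_{ik}]_+[-g_k]_+$ ($i\neq k$); $\phi_{t',t}$ is the composition along any mutation sequence. $\psi_{t',t}:M^\circ(t)\to M^\circ(t')$ is the linear map with $\psi_{t',t}(f_i)=\phi_{t',t}(f_i)$ for all $i\in I$. Dominance order: for $g,g'\in M^\circ(t)$, $g'\preceq_tg$ iff $g'=g+\tilde B(t)n$ for some $n\in\mathbb N^{I_{uf}}$. Injective-reachability: every cluster variable $x_k(t')$ of a seed $t'$ related to $t$ by mutations can be written $x_k(t')=x(t)^{g_k}(1+\sum_{0\neq n\in\mathbb N^{I_{uf}}}c_nx(t)^{\tilde B(t)n})$ with $g_k=g^t_k(t')\in M^\circ(t)$ ($g$-vector).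 $t$ is injective-reachable if there are such a seed $t'=t[1]$ and a permutation $\sigma$ of $I_{uf}$ with $g_k^t(t[1])\in-f_{\sigma(k)}+\mathbb Z^{I_f}$ for all $k\in I_{uf}$. If one seed is injective-reachable so are all related seeds; $t[-1]$ is a seed with $(t[-1])[1]=t$, and $\overleftarrow\mu$ is a mutation sequence from $t[-1]$ to $t$. *)

(* Defs.v *)
From HB Require Import structures.
From mathcomp Require Export all_boot all_order all_algebra all_fingroup.
From mathcomp Require Export archimedean mpoly.

Set Implicit Arguments.
Unset Strict Implicit.
Unset Printing Implicit Defensive.

Import Order.TTheory GRing.Theory Num.Theory.
Local Open Scope ring_scope.

(* Index sets: I_uf = 'I_u, I_f = 'I_f, I = 'I_(u + f), where k : 'I_u is
   seen in I as lshift f k and i : 'I_f as rshift u i. *)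

Definition pospart (R : realDomainType) (a : R) : R := Num.max a 0.

(* Matrix mutation of a rectangular matrix; kr and kc are the row and the
   column carrying the label k. *)
Definition mx_mut (R : realDomainType) (r c : nat) (kr : 'I_r) (kc : 'I_c)
    (A : 'M[R]_(r, c)) : 'M[R]_(r, c) :=
  \matrix_(i, j)
    if (i == kr) || (j == kc) then - A i j
    else A i j + A i kc * pospart (A kr j) + pospart (- A i kc) * A kr j.

(* x^g for an integer exponent vector g. *)
Definition monom (F : fieldType) (l : nat) (x : 'I_l -> F) (g : 'cV[int]_l) : F :=
  \prod_(i < l) x i ^ g i 0.

(* Raw seed data; all seeds related by mutations have their cluster variables
   in a common ambient field F, which realises the identification of the
   fraction fields. *)
Record seed (u f : nat) (F : fieldType) := Seed {
  bmat : 'M[rat]_(u + f);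
  xvar : 'I_(u + f) -> F
}.

Definition alg_indep (F : fieldType) (l : nat) (x : 'I_l -> F) : Prop :=
  forall p : {mpoly int[l]}, mmap (intr : int -> F) x p = 0 -> p = 0.

Definition both_frozen (u f : nat) (i j : 'I_(u + f)) : bool :=
  (u <= i)%N && (u <= j)%N.

Record is_seed (u f : nat) (F : fieldType) (d : 'I_(u + f) -> int)
    (t : seed u f F) : Prop := IsSeed {
  seed_skew : forall i j, bmat t i j * (d j)%:~R = - (bmat t j i * (d i)%:~R);
  seed_int : forall i j, ~~ both_frozen i j -> bmat t i j \is a Num.int;
  seed_indep : alg_indep (xvar t)
}.

Section Seeds.
Variables (u f : nat) (F : fieldType).
Implicit Types (t : seed u f F) (k : 'I_u) (ks : seq 'I_u).

(* These columns have integer entries in a seed, so that floor only changes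
   the type of the entries. *)
Definition Btilde t : 'M[int]_(u + f, u) :=
  map_mx (Num.floor : rat -> int) (lsubmx (bmat t)).

Definition Bprin t : 'M[int]_u := usubmx (Btilde t).

Definition full_rank t : Prop :=
  \rank (map_mx (intr : int -> rat) (Btilde t)) = u.

Definition seed_mut t k : seed u f F :=
  Seed (mx_mut (lshift f k) (lshift f k) (bmat t))
    (fun i => if i == lshift f k then
       (xvar t i)^-1 *
         (monom (xvar t) (\col_j pospart (- Btilde t j k))
          + monom (xvar t) (\col_j pospart (Btilde t j k)))
     else xvar t i).

(* The head of the sequence is the first direction of mutation. *)
Definition seed_muts t ks : seed u f F := foldl seed_mut t ks.

Definition Cmat t ks : 'M[int]_u :=
  dsubmx (foldl (fun A k => mx_mut (lshift u k) k A)
                (col_mx (Bprin t) 1%:M) ks).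

Definition Pmat (s : 'S_u) : 'M[int]_u := \matrix_(i, k) (i == s k)%:R.

Definition trop_mut t k (g : 'cV[int]_(u + f)) : 'cV[int]_(u + f) :=
  \col_i if i == lshift f k then - g i 0
         else g i 0 + pospart (Btilde t i k) * pospart (g (lshift f k) 0)
              - pospart (- Btilde t i k) * pospart (- g (lshift f k) 0).

(* phi_{t', t} for t' = seed_muts t ks, computed along ks. *)
Fixpoint phi t ks (g : 'cV[int]_(u + f)) : 'cV[int]_(u + f) :=
  if ks is k :: ks' then phi (seed_mut t k) ks' (trop_mut t k g) else g.

(* psi_{t', t} for t' = seed_muts t ks. *)
Definition psi t ks (g : 'cV[int]_(u + f)) : 'cV[int]_(u + f) :=
  \sum_(i < u + f) g i 0 *: phi t ks (delta_mx i 0).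

(* dom_le t g' g is g' <=_t g. *)
Definition dom_le t (g' g : 'cV[int]_(u + f)) : Prop :=
  exists n : 'cV[int]_u, (forall k, 0 <= n k 0) /\ g' = g + Btilde t *m n.

(* z = x(t)^g (1 + sum over 0 != a in N^I_uf of c_a x(t)^(Btilde t a)), the
   finitely supported family c being stored as a polynomial. *)
Definition is_gvector t (z : F) (g : 'cV[int]_(u + f)) : Prop :=
  exists c : {mpoly int[u]},
    z = monom (xvar t) g *
        (1 + \sum_(a <- msupp c | a != 0%MM)
               (c@_a)%:~R *
               monom (xvar t) (Btilde t *m (\col_k ((a k)%:Z : int)))).

(* t' has the property characterising t[1]. *)
Definition is_shift t t' : Prop :=
  exists s : 'S_u, forall k, exists g : 'cV[int]_(u + f),
    is_gvector t (xvar t' (lshift f k)) g /\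
    exists h : 'cV[int]_f, g = - delta_mx (lshift f (s k)) 0 + col_mx 0 h.

Definition injective_reachable t : Prop :=
  exists ks, is_shift t (seed_muts t ks).

End Seeds.

(* Main.v *)
Require Import Defs.
From mathcomp Require Import ring lra zify.

(* Let B0 = Btilde tm, B = Btilde t, and let G be the square integer matrix
   whose columns are the g-vectors of the cluster variables of t with respect
   to tm, completed by the unit vectors f_j for j frozen.  Then psi is
   multiplication by G and G B = B0 C, where C = - P_s is the C-matrix; as G
   is invertible, the theorem follows.

   Both identities come from the tropical evolution a |-> a(t) of exponents
   a in Z^I of the cluster variables.  Substituting x_i(tm) = T^(a_i) with
   T -> 0 in x_k(t) = x(tm)^g_k (1 + ...) gives a(t) = a G when a B0 > 0, and,
   by homogeneity and continuity, when a B0 >= 0.  If a B0 is a multiple of a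
   unit vector, then (a B0)(t) = a(t) B is the same multiple of a row of C;
   this gives G B = B0 C.

   The pairing of a with a g-vector v changes under mutation at k by
   [v_k]_+ [(a B0)_k]_+ - [-v_k]_+ [-(a B0)_k]_+.  This vanishes along the
   whole mutation sequence for v = - D (a1 B0)^T and a = N a1 + b with N large,
   because v and a B0 then have opposite signs.  Hence
   a G phi_{t, tm}(v) = a v, and choosing a1 B0 proportional to unit vectors
   yields G phi_{t, tm}(- f_i) = - f_i for i unfrozen. *)

Set Implicit Arguments.
Unset Strict Implicit.
Unset Printing Implicit Defensive.

Import Order.TTheory GRing.Theory Num.Theory.
Local Open Scope ring_scope.

(** * Mutation of matrices, g-vectors and exponents *)

Lemma pospart_id (R : realDomainType) (a : R) : 0 <= a -> pospart a = a.
Proof. exact: max_l. Qed.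

Lemma pospart_eq0 (R : realDomainType) (a : R) : a <= 0 -> pospart a = 0.
Proof. exact: max_r. Qed.

Lemma pospartBN (R : realDomainType) (a : R) : pospart a - pospart (- a) = a.
Proof.
case: (lerP 0 a) => a0.
  by rewrite pospart_id // pospart_eq0 ?subr0 // oppr_le0.
by rewrite pospart_eq0 ?(ltW a0) // pospart_id ?oppr_ge0 ?(ltW a0) // sub0r opprK.
Qed.

Lemma pospartM (R : realDomainType) (c a : R) :
  0 <= c -> pospart (c * a) = c * pospart a.
Proof. by move=> c0; rewrite /pospart maxr_pMr // mulr0. Qed.

Lemma sub_minr (R : realDomainType) (x y : R) : y - Num.min x y = pospart (y - x).
Proof.
case: (lerP x y) => xy; first by rewrite pospart_id // subr_ge0.
by rewrite subrr pospart_eq0 // subr_le0 ltW.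
Qed.

Section TropicalMutation.
Variables (u f : nat).
Implicit Types (B : 'M[int]_(u + f, u)) (k : 'I_u) (ks : seq 'I_u).
Implicit Types (a : 'rV[int]_(u + f)) (g : 'cV[int]_(u + f)).

(** The unfrozen columns mutate among themselves, so the tropical maps can be studied on this
    integer matrix alone, before seeds and cluster variables enter. *)
Definition mutB B k := mx_mut (lshift f k) k B.
Definition mutsB B ks := foldl mutB B ks.

Definition trop_gB B k g : 'cV[int]_(u + f) :=
  \col_i if i == lshift f k then - g i 0
         else g i 0 + pospart (B i k) * pospart (g (lshift f k) 0)
              - pospart (- B i k) * pospart (- g (lshift f k) 0).

Fixpoint phiB B ks g :=
  if ks is k :: ks' then phiB (mutB B k) ks' (trop_gB B k g) else g.

(* The tropical version of the exchange relation of the cluster variables. *)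
Definition trop_x B k a : 'rV[int]_(u + f) :=
  \row_i if i == lshift f k then
      - a 0 i + Num.min (\sum_j a 0 j * pospart (- B j k))
                        (\sum_j a 0 j * pospart (B j k))
    else a 0 i.

Fixpoint trop_xs B ks a :=
  if ks is k :: ks' then trop_xs (mutB B k) ks' (trop_x B k a) else a.

Lemma mutsB_cat B ks1 ks2 : mutsB B (ks1 ++ ks2) = mutsB (mutsB B ks1) ks2.
Proof. exact: foldl_cat. Qed.

Lemma phiB_cat B ks1 ks2 g :
  phiB B (ks1 ++ ks2) g = phiB (mutsB B ks1) ks2 (phiB B ks1 g).
Proof. by elim: ks1 B g => //= k ks1 IH B g; rewrite IH. Qed.

Lemma eq_lshiftE (i j : 'I_u) : (lshift f i == lshift f j) = (i == j).
Proof. exact: (inj_eq (@lshift_inj _ _)). Qed.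

Lemma mutBE B k i j : mutB B k i j =
  if (i == lshift f k) || (j == k) then - B i j
  else B i j + B i k * pospart (B (lshift f k) j)
       + pospart (- B i k) * B (lshift f k) j.
Proof. by rewrite mxE. Qed.

Lemma trop_gBE B k g i : trop_gB B k g i 0 =
  if i == lshift f k then - g i 0
  else g i 0 + pospart (B i k) * pospart (g (lshift f k) 0)
       - pospart (- B i k) * pospart (- g (lshift f k) 0).
Proof. by rewrite mxE. Qed.

Lemma trop_xE B k a i : trop_x B k a 0 i =
  if i == lshift f k then
    - a 0 i + Num.min (\sum_j a 0 j * pospart (- B j k))
                      (\sum_j a 0 j * pospart (B j k))
  else a 0 i.
Proof. by rewrite mxE. Qed.

Lemma mutBK B k : mutB (mutB B k) k = B.
Proof.
apply/matrixP=> i j; rewrite !mutBE !eqxx !orbT /=.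
case: ifP => ijk; rewrite ijk ?opprK //.
(* Once entries are written as [[b]_+ - [-b]_+], the claim is a polynomial identity. *)
have e1 := esym (pospartBN (B i k)); have e2 := esym (pospartBN (B (lshift f k) j)).
rewrite ?opprK; move: e1 e2; move: (pospart (B i k)) (pospart (- B i k)).
by move: (pospart (B _ j)) (pospart (- B _ j)) => x y z w -> ->; ring.
Qed.

(** Both [B i k] and [g_k] change sign, so the second mutation exchanges the two correction terms
    and cancels them. *)
Lemma trop_gBK B k g : trop_gB (mutB B k) k (trop_gB B k g) = g.
Proof.
apply/colP=> i; rewrite !trop_gBE !mutBE !eqxx !orbT /=.
case: ifP => ik; rewrite ik ?opprK //; ring.
Qed.

Lemma mutsB_revK B ks : mutsB (mutsB B ks) (rev ks) = B.
Proof.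
elim: ks B => //= k ks IH B.
by rewrite rev_cons -cats1 mutsB_cat /mutsB /= -/(mutsB _ _) IH mutBK.
Qed.

Lemma phiB_revK B ks g : phiB (mutsB B ks) (rev ks) (phiB B ks g) = g.
Proof.
elim: ks B g => //= k ks IH B g.
by rewrite rev_cons -cats1 phiB_cat /= IH mutsB_revK trop_gBK.
Qed.

(** Only unfrozen coordinates of [g] enter the correction terms. *)
Lemma phiB_frozen B ks g (h : 'cV[int]_f) :
  phiB B ks (g + col_mx 0 h) = phiB B ks g + col_mx 0 h.
Proof.
elim: ks B g => //= k ks IH B g; rewrite -IH; congr phiB.
apply/colP=> i; rewrite !mxE; case: eqP => [->|_].
  by rewrite !(unsplitK (inl _)) mxE !addr0.
by rewrite (unsplitK (inl _)) mxE addr0; ring.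
Qed.

Lemma phiBZ B ks (c : int) g : 0 <= c -> phiB B ks (c *: g) = c *: phiB B ks g.
Proof.
move=> c0; elim: ks B g => //= k ks IH B g; rewrite -IH; congr phiB.
apply/colP=> i; rewrite !mxE -!mulrN !pospartM //; case: ifP => _; ring.
Qed.

Lemma trop_xs_frozen B ks a (i : 'I_f) :
  trop_xs B ks a 0 (rshift u i) = a 0 (rshift u i).
Proof. by elim: ks B a => //= k ks IH B a; rewrite IH trop_xE eq_rlshift. Qed.

Lemma phiB0 B ks : phiB B ks 0 = 0.
Proof. by have := phiBZ B ks 0 (lexx 0); rewrite !scale0r. Qed.

(** * Skew-symmetrizable matrices and the pairing of exponents with g-vectors *)

Definition skewB (d : 'I_u -> int) B := forall i j : 'I_u,
  B (lshift f i) j * d j = - (B (lshift f j) i * d i).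

Section Skew.
Variable d : 'I_u -> int.
Hypothesis d_gt0 : forall i, 0 < d i.

Lemma skewB_diag B k : skewB d B -> B (lshift f k) k = 0.
Proof. by move=> sk; have := sk k k; have := d_gt0 k; nia. Qed.

Lemma pospart_skewB B i j : skewB d B ->
  pospart (B (lshift f i) j) * d j = pospart (- B (lshift f j) i) * d i.
Proof.
move=> sk; rewrite ![pospart _ * _]mulrC -!pospartM ?(ltW (d_gt0 _)) //.
by rewrite ![d _ * _]mulrC sk mulNr.
Qed.

Lemma pospart_skewBN B i j : skewB d B ->
  pospart (- B (lshift f i) j) * d j = pospart (B (lshift f j) i) * d i.
Proof. by move=> /pospart_skewB ->. Qed.

Lemma skewB_mut B k : skewB d B -> skewB d (mutB B k).
Proof.
move=> sk i j; rewrite !mutBE !eq_lshiftE orbC.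
case: ifP => _; first by rewrite mulNr sk mulNr.
rewrite !mulrDl sk -[B _ k * _ * _]mulrA pospart_skewB //.
rewrite [B _ k * _]mulrCA (sk i k) -[pospart _ * _ * _]mulrA (sk k j).
have := pospart_skewBN i k sk; move: (pospart (- B (lshift f i) k)) => y.
rewrite [y * - _]mulrN [y * (_ * _)]mulrCA => ->; ring.
Qed.

(** With [P] and [M] the two sums in the exchange relation and [m] their minimum, [(a B)_k = P - M]
    has positive part [P - m] and negative part [M - m]. The coordinates other than [k] contribute
    [P [g_k]_+ - M [-g_k]_+], and coordinate [k] contributes [- m g_k]. *)
Lemma trop_x_pair B k a g : skewB d B ->
  trop_x B k a *m trop_gB B k g =
  a *m g + (pospart (g (lshift f k) 0) * pospart ((a *m B) 0 k)
   - pospart (- g (lshift f k) 0) * pospart (- (a *m B) 0 k))%:M.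
Proof.
move=> sk; apply/matrixP=> i0 j0; rewrite !ord1 {i0 j0} !mxE mulr1n.
set l := lshift f k; set P := \sum_j a 0 j * pospart (B j k).
set M := \sum_j a 0 j * pospart (- B j k).
have PM : \sum_j a 0 j * B j k = P - M.
  by rewrite -sumrB; apply: eq_bigr => j _; rewrite -mulrBr pospartBN.
rewrite PM opprB -(sub_minr M) -(sub_minr P) (minC P).
rewrite (bigD1 l) //= [\sum_j a 0 j * g j 0](bigD1 l) //= trop_gBE trop_xE eqxx -/M -/P.
have Bl : B l k = 0 by exact: skewB_diag.
have eqP : P = \sum_(j | j != l) a 0 j * pospart (B j k).
  by rewrite /P (bigD1 l) //= Bl pospart_id // mulr0 add0r.
have eqM : M = \sum_(j | j != l) a 0 j * pospart (- B j k).
  by rewrite /M (bigD1 l) //= Bl oppr0 pospart_id // mulr0 add0r.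
have -> : \sum_(i | i != l) trop_x B k a 0 i * trop_gB B k g i 0 =
    \sum_(i | i != l) a 0 i * g i 0 + P * pospart (g l 0) - M * pospart (- g l 0).
  rewrite eqP eqM !mulr_suml -big_split -sumrB /=.
  by apply: eq_bigr => j /negPf jl; rewrite trop_gBE trop_xE jl; ring.
move: (Num.min _ _) (\sum_(_ | _) _) => m S.
by have := pospartBN (g l 0); move: (pospart _) (pospart _) => x y <-; ring.
Qed.

(** So [a B] mutates like one more row appended to the exchange matrix; the minimum is absorbed by
    [[-(a B)_k]_+ = M - min(P, M)]. *)
Lemma trop_x_mulB B k a j : skewB d B -> (trop_x B k a *m mutB B k) 0 j =
  if j == k then - (a *m B) 0 j
  else (a *m B) 0 j + (a *m B) 0 k * pospart (B (lshift f k) j)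
       + pospart (- (a *m B) 0 k) * B (lshift f k) j.
Proof.
move=> sk; rewrite !mxE.
set l := lshift f k; set P := \sum_j a 0 j * pospart (B j k).
set M := \sum_j a 0 j * pospart (- B j k).
have Bl : B l k = 0 by exact: skewB_diag.
have PM : \sum_j a 0 j * B j k = P - M.
  by rewrite -sumrB; apply: eq_bigr => i _; rewrite -mulrBr pospartBN.
have eqM : M = \sum_(j | j != l) a 0 j * pospart (- B j k).
  by rewrite /M (bigD1 l) //= Bl oppr0 pospart_id // mulr0 add0r.
case: eqP => [->|/eqP jk].
  rewrite -sumrN; apply: eq_bigr => i _; rewrite mutBE trop_xE eqxx orbT.
  by case: eqP => [->|_]; rewrite ?Bl ?oppr0 ?mulr0 // mulrN.
rewrite PM opprB -(sub_minr P) (bigD1 l) //= mutBE trop_xE eqxx /= (minC P) -/M -/P.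
rewrite [\sum_i a 0 i * B i j](bigD1 l) //=.
have -> : \sum_(i | i != l) trop_x B k a 0 i * mutB B k i j =
   \sum_(i | i != l) a 0 i * B i j + (P - M) * pospart (B l j) + M * B l j.
  rewrite -PM eqM [\sum_j a 0 j * B j k](bigD1 l) //= Bl mulr0 add0r !mulr_suml -!big_split /=.
  by apply: eq_bigr => i /negPf il; rewrite mutBE trop_xE il (negPf jk) /=; ring.
move: (Num.min _ _) => m; ring.
Qed.

(** Up to the factors [d], skew-symmetry turns row [k] of [B] into column [k], so the rules for [g]
    and for [a B] match. The relation therefore persists along any mutation sequence. *)
Lemma trop_gB_mulB B k a g : skewB d B ->
  (forall j, g (lshift f j) 0 = - (d j * (a *m B) 0 j)) ->
  forall j, trop_gB B k g (lshift f j) 0 =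
            - (d j * (trop_x B k a *m mutB B k) 0 j).
Proof.
move=> sk ga j; rewrite trop_x_mulB // trop_gBE eq_lshiftE.
case: eqP => [->|_]; first by rewrite ga mulrN.
rewrite !ga opprK -(mulrN (d k)) !pospartM ?(ltW (d_gt0 _)) //.
rewrite !mulrA (pospart_skewB j k sk) (pospart_skewBN j k sk).
have e1 := esym (pospartBN (B (lshift f k) j)).
have e2 := esym (pospartBN ((a *m B) 0 k)).
move: e1 e2; move: (pospart (B _ j)) (pospart (- B _ j)) => x y.
by move: (pospart _) (pospart _) => z w -> ->; ring.
Qed.

(* A row of the C-matrix mutates as [a B]. *)
Lemma trop_xs_Cmat ks B (m : nat) (A : 'M[int]_(u + m, u)) a (c : int) (i : 'I_m) :
  skewB d B -> usubmx A = usubmx B -> 0 <= c ->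
  a *m B = c *: row i (dsubmx A) ->
  trop_xs B ks a *m mutsB B ks =
  c *: row i (dsubmx (foldl (fun A k => mx_mut (lshift m k) k A) A ks)).
Proof.
elim: ks B A a => //= k ks IH B A a sk AB c0 aB.
have AB' r j : A (lshift m r) j = B (lshift f r) j.
  by move/matrixP/(_ r j): AB; rewrite !mxE.
apply: IH => //; first exact: skewB_mut.
  by apply/matrixP=> r j; rewrite !mxE !AB' !(inj_eq (@lshift_inj _ _)).
have aB' j : (a *m B) 0 j = c * A (rshift u i) j.
  by move/rowP/(_ j): aB => ->; rewrite !mxE.
apply/rowP=> j; rewrite trop_x_mulB // !aB' !mxE !AB' eq_rlshift /=.
case: ifP => _; first by rewrite mulrN.
by rewrite -mulrN pospartM //; ring.
Qed.

End Skew.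
End TropicalMutation.

(** * Behaviour near a ray *)

Definition bounded (z : nat -> int) := exists K : int, forall N, `|z N| <= K.

Lemma eq_bounded z1 z2 : z1 =1 z2 -> bounded z1 -> bounded z2.
Proof. by move=> e [K zK]; exists K => N; rewrite -e. Qed.

Lemma bounded_cst c : bounded (fun=> c).
Proof. by exists `|c|. Qed.

Lemma boundedD z1 z2 :
  bounded z1 -> bounded z2 -> bounded (fun N => z1 N + z2 N).
Proof.
move=> [K1 zK1] [K2 zK2]; exists (K1 + K2) => N.
by rewrite (le_trans (ler_normD _ _)) // lerD.
Qed.

Lemma boundedMr z c : bounded z -> bounded (fun N => z N * c).
Proof. by move=> [K zK]; exists (K * `|c|) => N; rewrite normrM ler_wpM2r. Qed.

Lemma boundedN z : bounded z -> bounded (fun N => - z N).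
Proof. by move=> [K zK]; exists K => N; rewrite normrN. Qed.

Lemma bounded_sum (I : finType) (z : I -> nat -> int) :
  (forall i, bounded (z i)) -> bounded (fun N => \sum_i z i N).
Proof.
move=> /fin_all_exists[K zK]; exists (\sum_i K i) => N.
by rewrite (le_trans (ler_norm_sum _ _ _)) // ler_sum.
Qed.

Lemma bounded_min x y (x' y' : int) :
  bounded (fun N => x N - N%:Z * x') -> bounded (fun N => y N - N%:Z * y') ->
  bounded (fun N => Num.min (x N) (y N) - N%:Z * Num.min x' y').
Proof.
move=> [K1 xK] [K2 yK]; exists (K1 + K2) => N; have := xK N; have := yK N.
rewrite minr_pMr //; move: (N%:Z * x') (N%:Z * y') => v w.
by case: leP; case: leP; lia.
Qed.

Lemma bounded_mulrn_eq0 (c b : int) : bounded (fun N => N%:Z * c + b) -> c = 0.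
Proof.
move=> [K cK]; apply/eqP; apply: contraT => c0.
(* If [c] is nonzero, then [|N c + b| >= N - |b| > K] for this [N]. *)
have := cK (`|K| + `|b| + 1)%N; set N := (_ + 1)%N => cKN.
have Nc : N%:Z <= `|N%:Z * c| by rewrite normrM ler_peMr // -gtz0_ge1 normr_gt0.
have NE : N%:Z = `|K| + `|b| + 1 by rewrite /N !PoszD !abszE.
lia.
Qed.

Section Asymptotics.
Variables (u f : nat) (d : 'I_u -> int).
Hypothesis d_gt0 : forall i, 0 < d i.
Implicit Types (B : 'M[int]_(u + f, u)) (k : 'I_u) (ks : seq 'I_u).
Implicit Types (a : 'rV[int]_(u + f)) (g : 'cV[int]_(u + f)).

(** Piecewise linear maps need not preserve affine sequences [N a + b], but they do preserve bounded
    distance from a ray. *)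
Definition near_ray l (al : nat -> 'rV[int]_l) (a : 'rV[int]_l) :=
  forall i, bounded (fun N => al N 0 i - N%:Z * a 0 i).

Lemma near_rayM l m (A : 'M[int]_(l, m)) (al : nat -> 'rV[int]_l) (a : 'rV[int]_l) :
  near_ray al a -> near_ray (fun N => al N *m A) (a *m A).
Proof.
move=> ala i; apply: (@eq_bounded (fun N => \sum_j (al N 0 j - N%:Z * a 0 j) * A j i)).
  by move=> N; rewrite !mxE mulr_sumr -sumrB; apply: eq_bigr => j _; ring.
by apply: bounded_sum => j; apply: boundedMr.
Qed.

Lemma near_ray_affine l (a b : 'rV[int]_l) : near_ray (fun N => N%:Z *: a + b) a.
Proof.
move=> i; apply: eq_bounded (bounded_cst (b 0 i)) => N.
by rewrite !mxE addrAC subrr add0r.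
Qed.

Lemma trop_x_near B k al a :
  near_ray al a -> near_ray (fun N => trop_x B k (al N)) (trop_x B k a).
Proof.
move=> ala i; have nearS (c : 'I_(u + f) -> int) :
    bounded (fun N => \sum_j al N 0 j * c j - N%:Z * \sum_j a 0 j * c j).
  have := near_rayM (\col_j c j) ala 0; apply: eq_bounded => N.
  by rewrite !mxE; congr (_ - _ * _); apply: eq_bigr => j _; rewrite mxE.
apply: (@eq_bounded (fun N => if i == lshift f k then
    - (al N 0 i - N%:Z * a 0 i)
    + (Num.min (\sum_j al N 0 j * pospart (- B j k))
               (\sum_j al N 0 j * pospart (B j k))
       - N%:Z * Num.min (\sum_j a 0 j * pospart (- B j k))
                        (\sum_j a 0 j * pospart (B j k)))
    else al N 0 i - N%:Z * a 0 i)).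
  by move=> N; rewrite !trop_xE; case: ifP => // _; ring.
case: (i == _) => //; apply: boundedD; first exact: boundedN.
by apply: bounded_min.
Qed.

Lemma trop_xs_near ks B al a :
  near_ray al a -> near_ray (fun N => trop_xs B ks (al N)) (trop_xs B ks a).
Proof. by elim: ks B al a => //= k ks IH B al a ala; apply/IH/trop_x_near. Qed.

(** The sequence of images stays near the rays of direction [trop_xs B ks a] and [a G], and a ray is
    determined by a sequence near it. *)
Lemma trop_xs_linear_closure B ks (G : 'M[int]_(u + f)) a b :
  (forall N : nat, trop_xs B ks (N%:Z *: a + b) = (N%:Z *: a + b) *m G) ->
  trop_xs B ks a = a *m G.
Proof.
move=> lin; apply/rowP=> i; apply/eqP; rewrite eq_sym -subr_eq0; apply/eqP.
apply: (@bounded_mulrn_eq0 _ ((b *m G) 0 i)).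
have := trop_xs_near ks B (near_ray_affine a b) i; apply: eq_bounded => N.
by rewrite lin mulmxDl -scalemxAl !mxE; ring.
Qed.

(* The correction terms of [trop_x_pair] vanish for large [N], because the
   signs of the entries of [al N *m B] are then opposite to those of [g]. *)
Lemma trop_xs_pair ks B a g al :
  skewB d B -> near_ray al a ->
  (forall j, g (lshift f j) 0 = - (d j * (a *m B) 0 j)) ->
  exists N0 : nat, forall N, (N0 <= N)%N ->
    trop_xs B ks (al N) *m phiB B ks g = al N *m g.
Proof.
elim: ks B a g al => [|k ks IH] B a g al sk ala ga; first by exists 0%N.
have [N0 IHN] := IH _ _ _ _ (skewB_mut d_gt0 k sk) (trop_x_near B k ala)
  (trop_gB_mulB d_gt0 k sk ga).
have [K alK] := near_rayM B ala k.
(* For [N > K], the bound [|q - N p| <= K] gives [q] the sign of a nonzero [p]; if [p = 0], then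
   [g_k = 0]. *)
exists (maxn N0 `|K|.+1) => N; rewrite geq_max => /andP[N0N KN] /=.
rewrite IHN // (trop_x_pair d_gt0) // ga opprK; move: (alK N) (d_gt0 k).
move: ((a *m B) 0 k) ((al N *m B) 0 k) => p q pq dk.
have [p0|p0|->] := ltrgt0P p.
- rewrite (@pospart_eq0 _ (- (_ * _))) ?oppr_le0 ?mulr_ge0 ?ltW //.
  by rewrite (@pospart_eq0 _ (- q)) ?mulr0 ?mul0r ?subr0 ?raddf0 ?addr0 //; nia.
- rewrite (@pospart_eq0 _ (_ * _)); last by nia.
  by rewrite (@pospart_eq0 _ q) ?mulr0 ?mul0r ?subr0 ?raddf0 ?addr0 //; nia.
by rewrite mulr0 oppr0 pospart_id // !mul0r subr0 raddf0 addr0.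
Qed.

End Asymptotics.

(** * Orders of growth and transfer to rational points *)

(* [X T] has order [m] as the positive number [T] tends to [0]. *)
Definition asym (X : rat -> rat) (m : int) := exists2 K, 1 <= K &
  forall T, 0 < T -> T * K <= 1 -> T ^ m <= K * X T /\ X T <= K * T ^ m.

Lemma eq_asym X1 X2 m :
  (forall T, 0 < T -> X1 T = X2 T) -> asym X1 m -> asym X2 m.
Proof. by move=> e [K K1 XK]; exists K => // T T0; rewrite -e //; apply: XK. Qed.

Lemma asym_exp m : asym (fun T => T ^ m) m.
Proof. by exists 1 => // T; rewrite mul1r. Qed.

Lemma asymM X1 X2 m1 m2 :
  asym X1 m1 -> asym X2 m2 -> asym (fun T => X1 T * X2 T) (m1 + m2).
Proof.
move=> [K K1 XK] [L L1 XL]; exists (K * L); first by rewrite mulr_ege1.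
move=> T T0 TKL; have [|Xl Xu] := XK T T0; first by nra.
have [|Yl Yu] := XL T T0; first by nra.
have p1 : 0 < T ^ m1 by rewrite exprz_gt0.
have p2 : 0 < T ^ m2 by rewrite exprz_gt0.
rewrite expfzDr ?gt_eqF // [K * L * _]mulrACA [K * L * _]mulrACA.
have q1 : 0 <= X1 T by nra.
have q2 : 0 <= X2 T by nra.
by rewrite !ler_pM // ltW.
Qed.

Lemma asymV X m : asym X m -> asym (fun T => (X T)^-1) (- m).
Proof.
move=> [K K1 XK]; exists K => // T T0 /XK-/(_ T0)[Xl Xu].
have p : 0 < T ^ m by rewrite exprz_gt0.
have q : 0 < X T by nra.
rewrite -invr_expz; move: (T ^ m) p Xl Xu => y y0 Xl Xu; split.
  by rewrite ler_pdivlMr // mulrC ler_pdivrMr.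
by rewrite ler_pdivlMr // mulrC ler_pdivrMr.
Qed.

Lemma asym_expz X m n : asym X m -> asym (fun T => X T ^ n) (m * n).
Proof.
move=> Xm; have Xn (k : nat) : asym (fun T => X T ^+ k) (m * k%:Z).
  elim: k => [|k IH]; first by rewrite mulr0; apply: asym_exp.
  rewrite -addn1 PoszD mulrDr mulr1; apply: eq_asym (asymM IH Xm) => T _.
  by rewrite addn1 exprSr.
case: n => k; first exact: Xn.
by rewrite NegzE mulrN; apply: asymV.
Qed.

(** Both functions are positive for small [T], so nothing cancels and the smaller exponent
    dominates. This is where sums become minima. *)
Lemma asymD X1 X2 m1 m2 :
  asym X1 m1 -> asym X2 m2 -> asym (fun T => X1 T + X2 T) (Num.min m1 m2).
Proof.
wlog m12 : X1 X2 m1 m2 / m1 <= m2.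
  move=> H X1m X2m; case: (leP m1 m2) => [m12|/ltW m21].
    by rewrite -(min_l m12); apply: H.
  rewrite -(min_l m21); apply: eq_asym (H _ _ _ _ m21 X2m X1m) => T _.
  exact: addrC.
move=> [K K1 XK] [L L1 XL]; rewrite min_l //.
have KL : L <= K * L by rewrite ler_peMl // (le_trans ler01).
have KK : K <= K * L by rewrite ler_peMr // (le_trans ler01).
exists (K * L + K * L); first by lra.
move=> T T0 TKL; have TT (M : rat) : M <= K * L + K * L -> T * M <= 1.
  by move=> MK; rewrite (le_trans _ TKL) // ler_pM2l.
have [|Xl Xu] := XK T T0; first by apply: TT; lra.
have [|Yl Yu] := XL T T0; first by apply: TT; lra.
have T1 : T <= 1 by rewrite -[T]mulr1 TT //; lra.
have p1 : 0 < T ^ m1 by rewrite exprz_gt0.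
have p2 : 0 < T ^ m2 by rewrite exprz_gt0.
have p12 : T ^ m2 <= T ^ m1.
  have [n ->] : exists n : nat, m2 = m1 + n%:Z.
    by exists `|m2 - m1|%N; rewrite gez0_abs ?subr_ge0 // addrCA subrr addr0.
  rewrite expfzDr ?gt_eqF // ler_piMr ?(ltW p1) //.
  by rewrite -exprnP exprn_ile1 // ltW.
have q1 : 0 < X1 T by nra.
have q2 : 0 < X2 T by nra.
move: (T ^ m1) (T ^ m2) (X1 T) (X2 T) (K * L) p1 p2 p12 q1 q2 KL KK Xl Xu Yl Yu.
by move=> x y X Y M; nra.
Qed.

Lemma asym_prod (I : finType) (X : I -> rat -> rat) (m : I -> int) :
  (forall i, asym (X i) (m i)) -> asym (fun T => \prod_i X i T) (\sum_i m i).
Proof.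
move=> Xm; elim: (index_enum I) => [|i s IH].
  by rewrite big_nil; apply: eq_asym (asym_exp 0) => T _; rewrite big_nil.
by rewrite big_cons; apply: eq_asym (asymM (Xm i) IH) => T _; rewrite big_cons.
Qed.

Lemma asym_unique X m1 m2 : asym X m1 -> asym X m2 -> m1 = m2.
Proof.
wlog m12 : m1 m2 / m1 < m2.
  by move=> H X1 X2; case: (ltgtP m1 m2) => // /H; [apply | move=> ->].
(* This [T] has [T K L = 1/2], whence [T^m1 <= K L T^m2 <= T^m1 / 2], a contradiction. *)
move=> [K K1 XK] [L L1 XL]; set T : rat := (2 * (K * L))^-1.
have KL : L <= K * L by rewrite ler_peMl // (le_trans ler01).
have KK : K <= K * L by rewrite ler_peMr // (le_trans ler01).
have T0 : 0 < T by rewrite invr_gt0; lra.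
have TKL : T * (K * L) = 2^-1.
  by rewrite /T invfM -mulrA mulVf ?mulr1 // gt_eqF //; lra.
have TT (M : rat) : M <= K * L -> T * M <= 1.
  move=> MK; have : T * M <= T * (K * L) by rewrite ler_pM2l.
  by rewrite TKL; lra.
have [|Xl Xu] := XK T T0; first by apply: TT.
have [|Yl Yu] := XL T T0; first by apply: TT.
have T1 : T <= 1 by rewrite -[T]mulr1 TT //; lra.
have p1 : 0 < T ^ m1 by rewrite exprz_gt0.
have p12 : T ^ m2 <= T ^ m1 * T.
  have [n ->] : exists n : nat, m2 = m1 + n.+1%:Z.
    by exists `|m2 - m1|.-1; lia.
  rewrite expfzDr ?gt_eqF // ler_pM2l // -exprnP exprSr.
  by rewrite ler_piMl ?exprn_ile1 // ltW.
exfalso; move: (T ^ m1) (T ^ m2) (X T) p1 p12 Xl Xu Yl Yu => x y z p1 p12 Xl Xu Yl Yu.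
have : x <= K * L * y by nra.
have : K * L * y <= x * (T * (K * L)) by nra.
rewrite TKL; lra.
Qed.

(* Only the constant term matters for small [T]. *)
Lemma asym_1D (I : eqType) (s : seq I) (P : pred I) (c : I -> int) (n : I -> int) :
  (forall i, P i -> 0 < n i) ->
  asym (fun T => 1 + \sum_(i <- s | P i) (c i)%:~R * T ^ n i) 0.
Proof.
move=> n0; pose S : rat := \sum_(i <- s | P i) `|(c i)%:~R|.
have S0 : 0 <= S by apply: sumr_ge0.
(* This constant forces [S T <= 1/2], so the value lies between [1/2] and [3/2]. *)
exists (2 + 2 * S); first by lra.
move=> T T0 TS; set Z := \sum_(_ <- _ | _) _.
have T1 : T <= 1 by nra.
have : `|Z| <= S * T.
  rewrite /S mulr_suml (le_trans (ler_norm_sum _ _ _)) //.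
  apply: ler_sum => i /n0 ni; rewrite normrM ler_wpM2l //.
  rewrite ger0_norm; last by rewrite exprz_ge0 // ltW.
  case: (n i) ni => // -[//|k] _; rewrite -exprnP exprSr.
  by rewrite ler_piMl ?exprn_ile1 // ltW.
by rewrite ler_norml expr0z => /andP[? ?]; split; nra.
Qed.

Section Transfer.
Variables (F : fieldType) (l : nat) (x : 'I_l -> F).
Hypothesis x_indep : alg_indep x.

Definition positive (tau : 'I_l -> rat) := forall i, 0 < tau i.

(* [z] and [w] are the values at [x] and at positive rational points of the
   same rational function. *)
Definition same_fun (z : F) (w : ('I_l -> rat) -> rat) :=
  exists P Q : {mpoly int[l]},
    [/\ Q != 0, z = mmap intr x P / mmap intr x Q &
     forall tau, positive tau -> mmap intr tau Q != 0 /\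
       w tau = mmap intr tau P / mmap intr tau Q].

Lemma mmap_neq0 Q : Q != 0 -> mmap (intr : int -> F) x Q != 0.
Proof. by apply: contraNneq => /x_indep ->. Qed.

(** Cross-multiplying gives a polynomial vanishing at [x]; by algebraic independence it is zero,
    hence vanishes at [tau]. *)
Lemma same_fun_unique z w1 w2 tau :
  same_fun z w1 -> same_fun z w2 -> positive tau -> w1 tau = w2 tau.
Proof.
move=> [P1 [Q1 [Q10 z1 w1E]]] [P2 [Q2 [Q20 z2 w2E]]] tau0.
have [n1 ->] := w1E _ tau0; have [n2 ->] := w2E _ tau0.
have /x_indep e : mmap (intr : int -> F) x (P1 * Q2 - P2 * Q1) = 0.
  rewrite rmorphB !rmorphM /=; apply/eqP.
  by rewrite subr_eq0 -eqr_div ?mmap_neq0 // -z1 -z2.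
apply/eqP; rewrite eqr_div // -subr_eq0 -!rmorphM -rmorphB.
by rewrite e rmorph0.
Qed.

Lemma eq_same_fun z w1 w2 :
  (forall tau, positive tau -> w1 tau = w2 tau) -> same_fun z w1 -> same_fun z w2.
Proof.
move=> e [P [Q [Q0 zE wE]]]; exists P, Q; split=> // tau tau0.
by rewrite -e //; apply: wE.
Qed.

Lemma same_fun_poly P : same_fun (mmap intr x P) (fun tau => mmap intr tau P).
Proof.
exists P, 1; split; rewrite ?oner_neq0 ?rmorph1 ?divr1 // => tau _.
by rewrite rmorph1 oner_neq0 divr1.
Qed.

Lemma same_fun_int c : same_fun c%:~R (fun=> c%:~R).
Proof.
have := same_fun_poly c%:MP; rewrite mmapC; apply: eq_same_fun => tau _.
by rewrite mmapC.
Qed.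

Lemma same_fun_var i : same_fun (x i) (fun tau => tau i).
Proof.
have := same_fun_poly 'X_i; rewrite mmapX mmap1U; apply: eq_same_fun => tau _.
by rewrite mmapX mmap1U.
Qed.

Lemma same_funD z1 w1 z2 w2 : same_fun z1 w1 -> same_fun z2 w2 ->
  same_fun (z1 + z2) (fun tau => w1 tau + w2 tau).
Proof.
move=> [P1 [Q1 [Q10 -> w1E]]] [P2 [Q2 [Q20 -> w2E]]].
exists (P1 * Q2 + P2 * Q1), (Q1 * Q2); split; first by rewrite mulf_neq0.
  by rewrite addf_div ?mmap_neq0 // rmorphD !rmorphM.
move=> tau tau0; have [n1 ->] := w1E _ tau0; have [n2 ->] := w2E _ tau0.
by rewrite rmorphM mulf_neq0 // addf_div // rmorphD !rmorphM.
Qed.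

Lemma same_funM z1 w1 z2 w2 : same_fun z1 w1 -> same_fun z2 w2 ->
  same_fun (z1 * z2) (fun tau => w1 tau * w2 tau).
Proof.
move=> [P1 [Q1 [Q10 -> w1E]]] [P2 [Q2 [Q20 -> w2E]]].
exists (P1 * P2), (Q1 * Q2); split; first by rewrite mulf_neq0.
  by rewrite mulf_div !rmorphM.
move=> tau tau0; have [n1 ->] := w1E _ tau0; have [n2 ->] := w2E _ tau0.
by rewrite rmorphM mulf_neq0 // mulf_div !rmorphM.
Qed.

(** Positivity of [w] keeps the numerator nonzero at positive points, so it may become the
    denominator. *)
Lemma same_funV z w : (forall tau, positive tau -> 0 < w tau) ->
  same_fun z w -> same_fun z^-1 (fun tau => (w tau)^-1).
Proof.
move=> w0 [P [Q [Q0 -> wE]]]; have P0 tau : positive tau -> mmap intr tau P != 0.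
  move=> tau0; apply: contraTneq (w0 _ tau0) => P0.
  by have [_ ->] := wE _ tau0; rewrite P0 mul0r ltxx.
exists Q, P; split; last 1 first.
- move=> tau tau0; split; first exact: P0.
  by have [_ ->] := wE _ tau0; rewrite invf_div.
(* The numerator is a nonzero polynomial because its value at [(1, ..., 1)] is nonzero. *)
- have := P0 (fun=> 1) (fun=> ltr01); apply: contraNneq => ->.
  by rewrite rmorph0.
by rewrite invf_div.
Qed.

Lemma same_funXz z w n : (forall tau, positive tau -> 0 < w tau) ->
  same_fun z w -> same_fun (z ^ n) (fun tau => w tau ^ n).
Proof.
move=> w0 zw; have zwn (k : nat) : same_fun (z ^+ k) (fun tau => w tau ^+ k).
  elim: k => [|k IH]; first exact: (same_fun_int 1).
  rewrite exprS; apply: eq_same_fun (same_funM zw IH) => tau _.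
  by rewrite exprS.
case: n => k; first exact: zwn.
by apply: same_funV => // tau tau0; rewrite exprn_gt0 ?w0.
Qed.

Lemma same_fun_sum (I : Type) (s : seq I) (P : pred I) z w :
  (forall i, same_fun (z i) (w i)) ->
  same_fun (\sum_(i <- s | P i) z i) (fun tau => \sum_(i <- s | P i) w i tau).
Proof.
move=> zw; elim: s => [|i s IH].
  rewrite big_nil; apply: eq_same_fun (same_fun_int 0) => tau _.
  by rewrite big_nil.
rewrite big_cons; case: ifP => Pi; last first.
  by apply: eq_same_fun IH => tau _; rewrite big_cons Pi.
by apply: eq_same_fun (same_funD (zw i) IH) => tau _; rewrite big_cons Pi.
Qed.

Lemma same_fun_monom (z : 'I_l -> F) (w : ('I_l -> rat) -> 'I_l -> rat) g :
  (forall i tau, positive tau -> 0 < w tau i) ->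
  (forall i, same_fun (z i) (fun tau => w tau i)) ->
  same_fun (monom z g) (fun tau => monom (w tau) g).
Proof.
move=> w0 zw; rewrite /monom; elim: (index_enum _) => [|i s IH].
  rewrite big_nil; apply: eq_same_fun (same_fun_int 1) => tau _.
  by rewrite big_nil.
rewrite big_cons.
apply: eq_same_fun (same_funM (same_funXz (g i 0) (w0 i) (zw i)) IH) => tau _.
by rewrite big_cons.
Qed.

End Transfer.

(** * Tropicalization of cluster variables *)

Section ExchangeMatrix.
Variables (u f : nat).
Implicit Types (b : 'M[rat]_(u + f)) (k : 'I_u) (ks : seq 'I_u).

Definition mutb b k := mx_mut (lshift f k) (lshift f k) b.

Definition floor_lsub b : 'M[int]_(u + f, u) :=
  map_mx (Num.floor : rat -> int) (lsubmx b).

Definition int_cols b := forall i (j : 'I_u), b i (lshift f j) \is a Num.int.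

Lemma floor_lsubK b i j :
  int_cols b -> ((floor_lsub b i j)%:~R : rat) = b i (lshift f j).
Proof. by move=> bZ; rewrite !mxE floorK //; apply: bZ. Qed.

Lemma intr_pospart (c : int) : ((pospart c)%:~R : rat) = pospart c%:~R.
Proof.
case: (lerP 0 c) => c0; first by rewrite !pospart_id ?ler0z.
by rewrite !pospart_eq0 ?lerz0 // ltW.
Qed.

Lemma floor_lsub_mutE b k i j : int_cols b ->
  mutb b k i (lshift f j) = (mutB (floor_lsub b) k i j)%:~R.
Proof.
move=> bZ; rewrite mutBE mxE eq_lshiftE -!floor_lsubK //.
case: ifP => _; first by rewrite rmorphN.
by rewrite rmorphD rmorphD /= !intrM !intr_pospart rmorphN.
Qed.

Lemma int_cols_mut b k : int_cols b -> int_cols (mutb b k).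
Proof. by move=> bZ i j; rewrite floor_lsub_mutE // intr_int. Qed.

Lemma floor_lsub_mut b k :
  int_cols b -> floor_lsub (mutb b k) = mutB (floor_lsub b) k.
Proof.
by move=> bZ; apply/matrixP=> i j; rewrite 2!mxE floor_lsub_mutE // intrKfloor.
Qed.

Lemma phi_floor (F : fieldType) (t : seed u f F) ks g :
  int_cols (bmat t) -> phi t ks g = phiB (Btilde t) ks g.
Proof.
elim: ks t g => //= k ks IH t g tZ; rewrite IH; last exact: int_cols_mut.
by congr phiB; apply: floor_lsub_mut.
Qed.

Lemma seed_muts_int (F : fieldType) (t : seed u f F) ks :
  int_cols (bmat t) -> int_cols (bmat (seed_muts t ks)).
Proof. by elim: ks t => //= k ks IH t tZ; apply/IH/int_cols_mut. Qed.

Lemma Btilde_muts (F : fieldType) (t : seed u f F) ks :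
  int_cols (bmat t) -> Btilde (seed_muts t ks) = mutsB (Btilde t) ks.
Proof.
elim: ks t => //= k ks IH t tZ; rewrite IH; last exact: int_cols_mut.
by congr mutsB; apply: floor_lsub_mut.
Qed.

Lemma monom_gt0 l (x : 'I_l -> rat) g : (forall i, 0 < x i) -> 0 < monom x g.
Proof. by move=> x0; apply: prodr_gt0 => i _; rewrite exprz_gt0. Qed.

Lemma seed_mut_gt0 b (X : 'I_(u + f) -> rat) k i :
  (forall i, 0 < X i) -> 0 < xvar (seed_mut (Seed b X) k) i.
Proof.
move=> X0 /=; case: ifP => // _.
by rewrite mulr_gt0 ?invr_gt0 ?addr_gt0 ?monom_gt0.
Qed.

(** Exchange relations are subtraction-free. Hence running the same mutations on positive rational
    numbers evaluates the cluster variables. *)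
Lemma seed_muts_same_fun (F : fieldType) (x0 : 'I_(u + f) -> F) b ks x
    (X : ('I_(u + f) -> rat) -> 'I_(u + f) -> rat) i :
  alg_indep x0 ->
  (forall i tau, positive tau -> 0 < X tau i) ->
  (forall i, same_fun x0 (x i) (fun tau => X tau i)) ->
  same_fun x0 (xvar (seed_muts (Seed b x) ks) i)
              (fun tau => xvar (seed_muts (Seed b (X tau)) ks) i).
Proof.
move=> x0i; elim: ks b x X => [|k ks IH] b x X X0 xX; first exact: xX.
apply: (IH (mutb b k) (xvar (seed_mut (Seed b x) k))
  (fun tau => xvar (seed_mut (Seed b (X tau)) k))) => j.
  by move=> tau tau0; apply: seed_mut_gt0 => r; apply: X0.
rewrite /=; case: ifP => // _; apply: same_funM => //.
  by apply: same_funV => // tau; apply: X0.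
by apply: same_funD => //; apply: same_fun_monom.
Qed.

Lemma asym_monom l (X : rat -> 'I_l -> rat) (a : 'rV[int]_l) g :
  (forall i, asym (fun T => X T i) (a 0 i)) ->
  asym (fun T => monom (X T) g) (\sum_i a 0 i * g i 0).
Proof.
by move=> Xa; apply: asym_prod => i; apply: asym_expz.
Qed.

(** Under orders of growth, products become sums and sums become minima, which turns the exchange
    relation into [trop_x]. *)
Lemma asym_muts b ks (X : rat -> 'I_(u + f) -> rat) (a : 'rV[int]_(u + f)) i :
  int_cols b -> (forall i, asym (fun T => X T i) (a 0 i)) ->
  asym (fun T => xvar (seed_muts (Seed b (X T)) ks) i)
       (trop_xs (floor_lsub b) ks a 0 i).
Proof.
elim: ks b X a => [|k ks IH] b X a bZ Xa; first exact: Xa.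
rewrite /= -floor_lsub_mut //.
apply: (IH (mutb b k) (fun T => xvar (seed_mut (Seed b (X T)) k))) => [|j].
  exact: int_cols_mut.
rewrite trop_xE /=; case: eqP => [->|_]; last exact: Xa.
have M (c : 'I_(u + f) -> int) :
    asym (fun T => monom (X T) (\col_j c j)) (\sum_j a 0 j * c j).
  have -> : \sum_j a 0 j * c j = \sum_j a 0 j * (\col_j c j) j 0.
    by apply: eq_bigr => r _; rewrite mxE.
  exact: asym_monom.
apply: asymM; first exact: asymV.
by apply: asymD; apply: M.
Qed.

End ExchangeMatrix.

(** * Leading exponents of g-vector expansions *)

Section GVectors.
Variables (u f : nat) (F : fieldType) (t : seed u f F) (ks : seq 'I_u).
Hypothesis t_int : int_cols (bmat t).
Hypothesis t_indep : alg_indep (xvar t).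

Lemma monom_exp l (T : rat) (a : 'rV[int]_l) g :
  T != 0 -> monom (fun i => T ^ a 0 i) g = T ^ (a *m g) 0 0.
Proof.
move=> T0; rewrite mxE /monom; elim: (index_enum _) => [|i s IH].
  by rewrite !big_nil.
by rewrite !big_cons IH expfzDr // -exprz_exp.
Qed.

(** The order of the cluster variable at [x_j = T^(a_j)] is computed twice: by the exchange
    relations, and by the expansion, whose other terms carry positive powers of [T] because
    [a B > 0]. *)
Lemma gvector_trop a i g :
  is_gvector t (xvar (seed_muts t ks) i) g ->
  (forall j, 0 < (a *m Btilde t) 0 j) ->
  trop_xs (Btilde t) ks a 0 i = (a *m g) 0 0.
Proof.
move=> [c tc] a0; pose tau (T : rat) j := T ^ a 0 j.
pose col (m : 'X_{1.. u}) := \col_k ((m k)%:Z : int).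
have id_fun := seed_muts_same_fun (bmat t) ks i t_indep
  (fun i tau (tau0 : positive tau) => tau0 i) (same_fun_var (xvar t)).
have tau0 T : 0 < T -> positive (tau T) by move=> ? j; rewrite exprz_gt0.
have mon_fun v := same_fun_monom v (fun i tau (tau0 : positive tau) => tau0 i)
  (same_fun_var (xvar t)).
have rhs_fun := same_funM (mon_fun g)
  (same_funD t_indep (same_fun_int (xvar t) 1)
  (same_fun_sum t_indep (msupp c) (fun m => m != 0%MM) (fun m => same_funM
     (same_fun_int (xvar t) c@_m) (mon_fun (Btilde t *m col m))))).
have seedE : Seed (bmat t) (xvar t) = t by case: (t).
rewrite seedE tc in id_fun.
have XE T : 0 < T -> T ^ (a *m g) 0 0 *
    (1 + \sum_(m <- msupp c | m != 0%MM)
       (c@_m)%:~R * T ^ (a *m (Btilde t *m col m)) 0 0) =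
    xvar (seed_muts (Seed (bmat t) (tau T)) ks) i.
  move=> T0; rewrite (same_fun_unique t_indep id_fun rhs_fun (tau0 _ T0)).
  rewrite monom_exp ?gt_eqF //; congr (_ * (_ + _)).
  by apply: eq_bigr => m _; rewrite monom_exp ?gt_eqF.
apply: (@asym_unique (fun T => xvar (seed_muts (Seed (bmat t) (tau T)) ks) i)).
  by apply: asym_muts => // j; apply: asym_exp.
apply: eq_asym XE _; rewrite -[X in asym _ X]addr0; apply: asymM.
  exact: asym_exp.
apply: asym_1D => m m0; rewrite mulmxA mxE.
(* One nonzero coordinate of [m] makes the exponent [a B m] strictly positive. *)
have [r mr] : exists r, (0 < m r)%N.
  apply/existsP; apply: contraNT m0 => /existsPn m0; apply/eqP/mnmP=> r.
  by rewrite mnm0E; have := m0 r; rewrite -eqn0Ngt => /eqP.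
have colE j : col m j 0 = (m j)%:Z by rewrite mxE.
rewrite (bigD1 r) //= colE ltr_pwDl ?mulr_gt0 ?sumr_ge0 // => j _.
by rewrite colE mulr_ge0 // ltW.
Qed.

End GVectors.

(** * The matrix of g-vectors *)

Lemma common_denominator (I : finType) (q : I -> rat) :
  exists c : int, 0 < c /\ exists n : I -> int, forall i, c%:~R * q i = (n i)%:~R.
Proof.
exists (\prod_i denq (q i)); split; first by apply: prodr_gt0.
exists (fun i => numq (q i) * \prod_(j | j != i) denq (q j)) => i.
rewrite (bigD1 i) //= !intrM -[in X in _ * X = _](divq_num_den (q i)).
by field; rewrite intr_eq0 denq_neq0.
Qed.

(** A rational left inverse is cleared of denominators. The rows of [Y] are then integer exponents
    [a] with [a B] a multiple of a unit vector. *)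
Lemma scaled_left_inverse (m n : nat) (B : 'M[int]_(m, n)) :
  \rank (map_mx (intr : int -> rat) B) = n ->
  exists c : int, 0 < c /\ exists Y : 'M[int]_(n, m), Y *m B = c%:M.
Proof.
move=> rB; have /mulVpmx XB : row_full (map_mx (intr : int -> rat) B) by apply/eqP.
move: (pinvmx _) XB => X XB.
have [c [c0 [y yE]]] := common_denominator (fun ij : 'I_n * 'I_m => X ij.1 ij.2).
exists c; split => //; exists (\matrix_(i, j) y (i, j)).
suff /matrixP e : map_mx (intr : int -> rat) (\matrix_(i, j) y (i, j) *m B) =
    map_mx (intr : int -> rat) c%:M.
  by apply/matrixP=> i j; apply: (@intr_inj rat); have := e i j; rewrite !mxE.
rewrite map_mxM map_scalar_mx /= -[RHS]mulmx1 -XB mulmxA; congr (_ *m _).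
by rewrite mul_scalar_mx; apply/matrixP=> i j; rewrite !mxE -yE.
Qed.

Lemma delta_rshift (m n : nat) (i : 'I_n) :
  delta_mx (rshift m i) 0 = col_mx 0 (delta_mx i 0) :> 'cV[int]_(m + n).
Proof.
apply/colP=> r; case: (split_ordP r) => r' ->.
  by rewrite col_mxEu !mxE eq_lrshift.
by rewrite col_mxEd !mxE eq_rshift.
Qed.

Section Rank.
Variables (u f : nat).
Implicit Types (B : 'M[int]_(u + f, u)) (k : 'I_u).

(** [E] differs from the identity only in the column of [k], and [F] only in its row. *)
Lemma mutB_factor B k : B (lshift f k) k = 0 ->
  exists E F, mutB B k = E *m B *m F.
Proof.
move=> Bkk; set l := lshift f k.
(* The value -2 turns a diagonal 1 of the identity into -1. *)
pose e : 'cV[int]_(u + f) := \col_i if i == l then -2 else pospart (- B i k).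
pose r : 'rV[int]_u := \row_j if j == k then -2 else pospart (B l j).
exists (1%:M + e *m delta_mx 0 l), (1%:M + delta_mx k 0 *m r).
rewrite mulmxDl mul1mx -mulmxA -rowE mulmxDr mulmx1 mulmxA -colE.
apply/matrixP=> i j; rewrite mutBE !mxE !big_ord1 !mxE !big_ord1 !mxE Bkk mulr0.
by rewrite addr0; case: eqP => [->|_] /=; case: eqP => [->|_] /=;
  rewrite ?Bkk //; ring.
Qed.

(** Applied to the sequence from [t[-1]] to [t], this carries full rank from [t] back to [t[-1]]. *)
Lemma rank_mutsB (d : 'I_u -> int) B ks :
  (forall i, 0 < d i) -> skewB d B ->
  (\rank (map_mx (intr : int -> rat) (mutsB B ks)) <=
   \rank (map_mx (intr : int -> rat) B))%N.
Proof.
move=> d0; elim: ks B => //= k ks IH B sk.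
apply: (leq_trans (IH _ (skewB_mut d0 k sk))).
have [E [E' ->]] := mutB_factor (skewB_diag d0 k sk).
by rewrite !map_mxM (leq_trans (mxrankM_maxl _ _)) ?mxrankM_maxr.
Qed.

End Rank.

(** * Linearity on the cone [a B >= 0] and its consequences for [G] *)

Section LinearOnOrthant.
Variables (u f : nat) (d : 'I_u -> int) (B : 'M[int]_(u + f, u)) (ks : seq 'I_u).
Variables (c : int) (Y : 'M[int]_(u, u + f)) (G : 'M[int]_(u + f)).
Hypothesis d_gt0 : forall i, 0 < d i.
Hypothesis skB : skewB d B.
Hypothesis c_gt0 : 0 < c.
Hypothesis YB : Y *m B = c%:M.
Hypothesis G_lin : forall a, (forall j, 0 < (a *m B) 0 j) ->
  trop_xs B ks a = a *m G.
Hypothesis G_frozen : forall h : 'cV[int]_f, G *m col_mx 0 h = col_mx 0 h.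

(** An interior point of the cone, used to push other exponents into it. *)
Let b0 : 'rV[int]_(u + f) := const_mx 1 *m Y.

Lemma b0B j : (b0 *m B) 0 j = c.
Proof. by rewrite -mulmxA YB mul_mx_scalar !mxE mulr1. Qed.

(** The open cone spans: each unit row [b] equals [(N b0 + b) - N b0], and [N b0 + b] lies in the
    cone for large [N]. *)
Lemma orthant_eq0 (w : 'cV[int]_(u + f)) :
  (forall b : 'rV_(u + f), (forall j, 0 < (b *m B) 0 j) -> b *m w = 0) -> w = 0.
Proof.
move=> bw; have b0w : b0 *m w = 0 by apply: bw => j; rewrite b0B.
rewrite -[w]mul1mx; apply/row_matrixP=> r; rewrite row_mul row0.
set b := row r 1%:M; pose N := 1 + \sum_j `|(b *m B) 0 j|.
suff: (N *: b0 + b) *m w = 0 by rewrite mulmxDl -scalemxAl b0w scaler0 add0r.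
apply: bw => j.
rewrite mulmxDl -scalemxAl mxE [X in X + _]mxE b0B.
have pN : `|(b *m B) 0 j| < N.
  by rewrite /N (bigD1 j) //= addrCA ltrDl ltr_pwDl ?sumr_ge0.
have Nc : N <= N * c by rewrite ler_peMr ?(le_trans _ (ltW pN)) // -gtz0_ge1.
by move: (N * c) ((b *m B) 0 j) pN Nc => m p; lia.
Qed.

(** For [a = row i Y] the vector [- D (a B)^T] is [- c d_i f_i]. Invariance of the pairing along
    [N a + b], with [b] in the open cone, gives [(N a + b) w = 0] for the defect [w] and large
    [N]. *)
Lemma mulG_phi i : G *m phiB B ks (- delta_mx (lshift f i) 0) =
                   - delta_mx (lshift f i) 0.
Proof.
set del := - delta_mx _ _; set a := row i Y; set e := c * d i.
have e0 : 0 < e by rewrite mulr_gt0.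
have aB j : (a *m B) 0 j = if i == j then c else 0.
  by rewrite -row_mul YB !mxE; case: eqP.
have ga j : (e *: del) (lshift f j) 0 = - (d j * (a *m B) 0 j).
  rewrite aB !mxE eq_lshiftE eqxx andbT eq_sym.
  by case: eqP => [<-|_]; rewrite /e ?mulr1n ?mulr0n; ring.
have w0 : G *m phiB B ks (e *: del) - e *: del = 0.
  apply: orthant_eq0 => b bB.
  have [N0 pairN] := trop_xs_pair d_gt0 ks skB (near_ray_affine a b) ga.
  have pair0 N : (N0 <= N)%N ->
      (N%:Z *: a + b) *m (G *m phiB B ks (e *: del) - e *: del) = 0.
    move=> N0N; rewrite mulmxBr mulmxA -G_lin ?pairN ?subrr // => j.
    rewrite mulmxDl -scalemxAl mxE [X in X + _]mxE aB ltr_wpDl //.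
    by case: ifP => _; rewrite ?mulr0 // mulr_ge0 // ltW.
  move: (_ - _) pair0 => w pair0; have aw : a *m w = 0.
    (* Two consecutive values of [N] isolate [a w = 0], and then [b w = 0]. *)
    have -> : a = (N0.+1%:Z *: a + b) - (N0%:Z *: a + b).
      by rewrite opprD addrACA subrr addr0 -scalerBl intS addrK scale1r.
    by rewrite mulmxBl !pair0 ?subrr.
  by have := pair0 N0 (leqnn _); rewrite mulmxDl -scalemxAl aw scaler0 add0r.
move: w0; rewrite phiBZ ?(ltW e0) // -scalemxAr -scalerBr => /colP w0.
apply/colP => r; apply/eqP; rewrite -subr_eq0; apply/eqP.
by apply: (mulfI (lt0r_neq0 e0)); have := w0 r; rewrite mxE [X in _ * X]mxE
  [X in _ + X]mxE [RHS]mxE mulr0.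
Qed.

Lemma G_right_inverse : exists X, G *m X = 1%:M.
Proof.
have /fin_all_exists[x xE] (j : 'I_(u + f)) :
    exists x : 'cV[int]_(u + f), G *m x = delta_mx j 0.
  case: (split_ordP j) => i ->.
    by exists (- phiB B ks (- delta_mx (lshift f i) 0)); rewrite mulmxN mulG_phi opprK.
  exists (delta_mx (rshift u i) 0).
  by rewrite delta_rshift G_frozen.
exists (\matrix_(r, j) x j r 0); apply/matrixP=> r j.
have /colP/(_ r) := xE j; rewrite !mxE eqxx andbT => <-.
by apply: eq_bigr => k _; rewrite mxE.
Qed.

Lemma G_inj (m : nat) (V W : 'M_(u + f, m)) : G *m V = G *m W -> V = W.
Proof.
have [X /mulmx1C XG] := G_right_inverse => GVW.
by rewrite -[V]mul1mx -[W]mul1mx -XG -!mulmxA GVW.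
Qed.

(** By injectivity of [G], [- f_l] is sent by [phi] to [f_k] minus a frozen vector; the reversed
    sequence then sends [f_k] to its g-vector. *)
Lemma phi_rev_basis k l (h : 'cV[int]_f) :
  G *m delta_mx (lshift f k) 0 = - delta_mx (lshift f l) 0 + col_mx 0 h ->
  phiB (mutsB B ks) (rev ks) (delta_mx (lshift f k) 0) =
  G *m delta_mx (lshift f k) 0.
Proof.
move=> Gk; have phil : phiB B ks (- delta_mx (lshift f l) 0) =
    delta_mx (lshift f k) 0 + col_mx 0 (- h).
  apply: G_inj; rewrite mulG_phi mulmxDr G_frozen Gk.
  by rewrite -addrA add_col_mx addr0 subrr col_mx0 addr0.
have := phiB_revK B ks (- delta_mx (lshift f l) 0).
rewrite phil phiB_frozen Gk => <-.
by rewrite -addrA add_col_mx addr0 addNr col_mx0 addr0.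
Qed.

(** The boundary of the cone is reached through the interior points [N a + b0]. *)
Lemma trop_xs_orthant a : (forall j, 0 <= (a *m B) 0 j) ->
  trop_xs B ks a = a *m G.
Proof.
move=> a0; apply: (@trop_xs_linear_closure _ _ _ _ _ _ b0) => N.
apply: G_lin => j; rewrite mulmxDl -scalemxAl mxE [X in X + _]mxE b0B.
by rewrite ltr_wpDl ?mulr_ge0.
Qed.

(** For [X = G B'], with [B'] the mutated matrix, the rows of [Y] give [Y X = c C] and those of
    [c - B Y] give [(c - B Y) X = 0]; together [c X = c B C]. *)
Lemma mulGB : G *m mutsB B ks =
  B *m dsubmx (foldl (fun A k => mx_mut (lshift u k) k A)
                     (col_mx (usubmx B) 1%:M) ks).
Proof.
set C := dsubmx _.
have rowG a (e : int) i : 0 <= e -> a *m B = e *: row i 1%:M ->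
    a *m G *m mutsB B ks = e *: row i C.
  move=> e0 aB; rewrite -trop_xs_orthant.
    by apply: (trop_xs_Cmat d_gt0); rewrite ?col_mxKu ?col_mxKd.
  by move=> j; rewrite aB !mxE mulr_ge0 // ler0n.
have YG : Y *m (G *m mutsB B ks) = c *: C.
  apply/row_matrixP => i; rewrite row_mul mulmxA (rowG _ c i) ?ltW ?linearZ //.
  by rewrite -row_mul YB; apply/rowP=> j; rewrite !mxE mulr_natr.
(* The rows of [c - B Y] annihilate [B], so they fit [rowG] with the multiple 0 of any row [i0]. *)
have KG (i0 : 'I_u) : (c%:M - B *m Y) *m (G *m mutsB B ks) = 0.
  apply/row_matrixP => r; rewrite row_mul mulmxA (rowG _ 0 i0) ?scale0r ?row0 //.
  rewrite -row_mul mulmxBl -mulmxA YB mul_scalar_mx mul_mx_scalar subrr.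
  by rewrite row0.
apply/matrixP => i j; apply: (mulfI (lt0r_neq0 c_gt0)).
have := KG j; rewrite mulmxBl -mulmxA YG mul_scalar_mx -scalemxAr => /eqP.
by rewrite subr_eq0 => /eqP/matrixP/(_ i j); rewrite !mxE.
Qed.

End LinearOnOrthant.

(** * Identification of [psi] with multiplication by [G], and conclusion *)

Theorem proposition3p3p11 (u f : nat) (F : fieldType) (d : 'I_(u + f) -> int)
    (hd : forall i, 0 < d i)
    (tm t : seed u f F) (ks : seq 'I_u) (s : 'S_u)
    (htm : is_seed d tm)
    (ht : t = seed_muts tm ks)
    (hrank : full_rank t)
    (hinj : injective_reachable t)
    (hshift : is_shift tm t)
    (hC : Cmat tm ks = - Pmat s)
    (eta g : 'cV[int]_(u + f)) :
  (forall n : 'cV[int]_u,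
     eta = g + Btilde t *m n <->
     psi t (rev ks) eta = psi t (rev ks) g + Btilde tm *m (- (Pmat s *m n)))
  /\ (dom_le t eta g <-> dom_le tm (psi t (rev ks) g) (psi t (rev ks) eta)).
Proof.
have tmZ : int_cols (bmat tm).
  move=> i j; apply: (seed_int htm); rewrite /both_frozen negb_and -!ltnNge.
  by rewrite (ltn_ord j : (lshift f j < u)%N) orbT.
set B := Btilde tm; pose du i := d (lshift f i).
have du0 i : 0 < du i by exact: hd.
have skB : skewB du B.
  move=> i j; apply: (@intr_inj rat); rewrite rmorphN !rmorphM /=.
  by rewrite !floor_lsubK //; apply: (seed_skew htm).
have BtE : Btilde t = mutsB B ks by rewrite ht Btilde_muts.
have [c [c0 [Y YB]]] : exists c : int, 0 < c /\
    exists Y : 'M[int]_(u, u + f), Y *m B = c%:M.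
  apply: scaled_left_inverse; apply/eqP; rewrite eqn_leq rank_leq_col /=.
  by rewrite -[leqLHS]hrank BtE (rank_mutsB ks du0 skB).
have [s' /fin_all_exists[gv gvE]] := hshift.
pose G : 'M[int]_(u + f) := row_mx (\matrix_(i, k) gv k i 0) (col_mx 0 1%:M).
have Guf k : G *m delta_mx (lshift f k) 0 = gv k.
  by rewrite -colE colKl; apply/colP=> i; rewrite !mxE.
have Gfr (h : 'cV[int]_f) : G *m col_mx 0 h = col_mx 0 h.
  by rewrite mul_row_col mulmx0 add0r mul_col_mx mul0mx mul1mx.
have Glin a : (forall j, 0 < (a *m B) 0 j) -> trop_xs B ks a = a *m G.
  move=> aB; apply/rowP=> i; case: (split_ordP i) => k ->.
    have [gk _] := gvE k; rewrite ht in gk.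
    rewrite (gvector_trop tmZ (seed_indep htm) gk aB) -Guf mulmxA -colE.
    by rewrite mxE.
  have -> : (a *m G) 0 (rshift u k) = a 0 (rshift u k).
    rewrite mul_mx_row row_mxEr mxE (bigD1 (rshift u k)) //=.
    rewrite col_mxEd mxE eqxx mulr1 big1 ?addr0 // => r.
    case: (split_ordP r) => r' ->; first by rewrite col_mxEu mxE mulr0.
    by rewrite eq_rshift col_mxEd mxE => /negPf->; rewrite mulr0.
  exact: trop_xs_frozen.
(* It suffices to compare on basis vectors: unfrozen ones go to their g-vectors, frozen ones are
   fixed. *)
have psiE v : psi t (rev ks) v = G *m v.
  rewrite /psi [in RHS](matrix_sum_delta v) mulmx_sumr; apply: eq_bigr => i _.
  rewrite big_ord1 -scalemxAr; congr (_ *: _).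
  rewrite phi_floor; last by rewrite ht; apply: seed_muts_int.
  rewrite BtE; case: (split_ordP i) => k ->.
    have [_ [h gkE]] := gvE k.
    by apply: (phi_rev_basis du0 skB c0 YB Glin Gfr (h := h)); rewrite Guf gkE.
  by rewrite delta_rshift Gfr -[col_mx _ _]add0r phiB_frozen phiB0.
have GB : G *m Btilde t = - (B *m Pmat s).
  by rewrite BtE (mulGB du0 skB c0 YB Glin) -/(Cmat tm ks) hC mulmxN.
have Ginj := G_inj du0 skB c0 YB Glin Gfr.
have part1 n : eta = g + Btilde t *m n <->
    psi t (rev ks) eta = psi t (rev ks) g + B *m (- (Pmat s *m n)).
  have -> : psi t (rev ks) g + B *m (- (Pmat s *m n)) = G *m (g + Btilde t *m n).
    by rewrite psiE mulmxDr mulmxN !mulmxA GB mulNmx.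
  by rewrite psiE; split=> [->|/Ginj].
split=> //.
have PE n k : (Pmat s *m n) (s k) 0 = n k 0.
  rewrite mxE (bigD1 k) //= mxE eqxx mul1r big1 ?addr0 // => j jk.
  by rewrite mxE (inj_eq perm_inj) eq_sym (negPf jk) mul0r.
split=> [[n [n0 /part1 etaE]]|[m [m0 gE]]].
  exists (Pmat s *m n); split=> [k|]; first by rewrite -(permKV s k) PE.
  by rewrite etaE mulmxN addrNK.
(* The solution of [P_s n = m]; permuting coordinates preserves nonnegativity, while the sign of
   [- P_s] reverses the order. *)
exists (\col_k m (s k) 0); split=> [k|]; first by rewrite mxE.
apply/part1; have -> : Pmat s *m \col_k m (s k) 0 = m.
  by apply/colP=> k; rewrite -(permKV s k) PE mxE.
by rewrite gE mulmxN addrK.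
Qed.
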